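(* Let $r\ge 3$ and $t>1$ be fixed integers. Then $$\mathrm{ex}_r(n,F(t,r))=t\binom{n}{r-1}+O(n^{r-2}).$$
   Context: Let $\mathcal K_r^{(r-1)}$ denote the complete $(r-1)$-uniform hypergraph on $r$ vertices. Let $\mathcal F$ be the $(r-1)$-graph on $t(r-1)+1$ vertices consisting of $t$ copies of $\mathcal K_r^{(r-1)}$ that pairwise intersect in exactly one common vertex (and are otherwise vertex-disjoint); it has $tr$ hyperedges. $F(t,r)$ is the $r$-graph obtained from $\mathcal F$ by adding to each of its $tr$ hyperedges one new vertex, where these $tr$ new vertices are distinct from each other and do not belong to $V(\mathcal F)$. $\mathrm{ex}_r(n,\mathcal G)$ denotes the maximum number of hyperedges in an $n$-vertex $r$-graph not containing $\mathcal G$ as a subhypergraph. *)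

(* Defs.v *)
From mathcomp Require Import all_boot.
Set Implicit Arguments. Unset Strict Implicit. Unset Printing Implicit Defensive.

Definition uniform (V : finType) (r : nat) (E : {set {set V}}) : bool :=
  [forall e in E, #|e| == r].

Definition contains (V : finType) (E : {set {set V}}) (n : nat)
  (H : {set {set 'I_n}}) : bool :=
  [exists f : {ffun V -> 'I_n}, injectiveb f && [forall e in E, (f @: e) \in H]].

Definition ex (r n : nat) (V : finType) (E : {set {set V}}) : nat :=
  \max_(H : {set {set 'I_n}} | uniform r H && ~~ contains E H) #|H|.

(* The construction of F(t,r).
   Core vertices of the (r-1)-graph calF: None = common vertex of all
   copies; Some (i, j) = the j-th non-common vertex of copy i (j < r-1).
   Copy i of K_r^{(r-1)} has vertex set {None} U {Some (i,j)}; its r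
   hyperedges are indexed by m : option 'I_(r-1), the missing vertex
   (None = the common vertex is missing, Some j = Some (i,j) missing).
   New vertices: inr (i, m), one for each hyperedge (i, m) of calF. *)
Definition coreV (t r : nat) := option ('I_t * 'I_r.-1)%type.
Definition FV (t r : nat) := (coreV t r + ('I_t * option 'I_r.-1))%type.

Definition inCopy (t r : nat) (i : 'I_t) (x : coreV t r) : bool :=
  match x with None => true | Some p => p.1 == i end.

Definition calF_edge (t r : nat) (i : 'I_t) (m : option 'I_r.-1) : {set coreV t r} :=
  [set x : coreV t r | inCopy i x && (x != omap (pair i) m)].

Definition F_edge (t r : nat) (i : 'I_t) (m : option 'I_r.-1) : {set FV t r} :=
  (@inl _ _ @: calF_edge i m) :|: [set inr (i, m)].

Definition F_edges (t r : nat) : {set {set FV t r}} :=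
  [set F_edge i m | i : 'I_t, m : option 'I_r.-1].

(* Main.v *)
Require Import Defs.
From mathcomp Require Import all_boot.
Set Implicit Arguments. Unset Strict Implicit. Unset Printing Implicit Defensive.

(** Lower bound: every vertex cover of F(t, r) has more than t vertices, so the
    r-sets meeting a fixed t-set form an F(t, r)-free hypergraph.

    Upper bound: give each edge e the weight equal to the sum over its
    (r-1)-subsets A of 1/deg A. The total weight is at most C(n, r-1), so at most
    t C(n, r-1) edges have weight at least 1/t. In a remaining edge the j-th
    smallest degree of an (r-1)-subset exceeds jt. Hence if many remaining edges
    pairwise meet exactly in one common vertex v, then t of them can be taken as
    the copies of K_r^(r-1), and their (r-1)-subsets can be extended greedily,
    in increasing order of degree, by distinct new vertices. Otherwise each
    vertex v has a bounded set T(v), not containing v, that meets every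
    remaining edge through v; then each remaining edge is determined, up to
    boundedly many choices, by r-2 of its vertices, and there are O(n^(r-2)) of
    them. *)

(** * Distinct representatives, and independent sets in digraphs *)

(** Greedy choice in increasing order of size: the hypothesis forces the largest of any m of the
    sets to have at least m elements, so it keeps a free element once the others are represented. *)
Lemma distinct_representatives (I V : finType) (X : I -> {set V}) :
    (forall k, #|[set i | #|X i| <= k]| <= k) ->
  exists2 f : I -> V, injective f & forall i, f i \in X i.
Proof.
move=> small.
have X_gt0 i : exists x, x \in X i.
  apply/set0Pn; rewrite -card_gt0 lt0n; apply/negP => Xi0.
  have := small 0; rewrite leqn0 cards_eq0 => /eqP /setP /(_ i).
  by rewrite !inE (eqP Xi0).
suff [f injf fX] : exists2 f : I -> V, {in [set: I] &, injective f} &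
    forall i, i \in [set: I] -> f i \in X i.
  by exists f => [i j | i]; [apply: injf | apply: fX]; rewrite inE.
move: [set: I] => S; have [m] := ubnP #|S|.
elim: m S => // m IHm S; rewrite ltnS => leSm.
have [-> | [i0 Si0]] := set_0Vmem S.
  by exists (fun i => xchoose (X_gt0 i)) => [i j|i]; rewrite ?inE.
have [i Si' maxi] := arg_maxnP (fun j => #|X j|) Si0.
have Si : i \in S by [].
have ltSi : #|S :\ i| < #|S| by rewrite (cardsD1 i S) Si.
have [f injf fX] := IHm (S :\ i) (leq_trans ltSi leSm).
have leSX : #|S| <= #|X i|.
  rewrite leqNgt; apply/negP => ltXS.
  have := small #|X i|; rewrite leqNgt => /negP; apply.
  apply: leq_trans ltXS (subset_leq_card _).
  by apply/subsetP => j Sj; rewrite inE; apply: maxi.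
have /subsetPn[x Xx notfx] : ~~ (X i \subset f @: (S :\ i)).
  apply: contraTN (leq_trans ltSi leSX) => /subset_leq_card leX.
  by rewrite -leqNgt (leq_trans leX) ?leq_imset_card.
exists (fun j => if j == i then x else f j) => [j l Sj Sl | j Sj].
  case: eqVneq => [-> | ji]; case: eqVneq => [-> | li] //=.
  - by move=> xf; case/negP: notfx; rewrite xf imset_f // !inE li.
  - by move=> xf; case/negP: notfx; rewrite -xf imset_f // !inE ji.
  - by apply: injf; rewrite !inE ?ji ?li.
by case: eqVneq => [-> | ji] //; apply: fX; rewrite !inE ji.
Qed.

(** Since out-degrees are at most [d], counting arcs twice gives a vertex of in-degree at most [d].
    Select it, discard it with its at most [d + d] neighbours, and repeat [t] times. *)
Lemma independent_subset (T : finType) (E : rel T) (d t : nat) (S : {set T}) :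
    (forall x, x \in S -> #|[set y in S | E x y]| <= d) ->
    t * (d + d).+1 <= #|S| ->
  exists Q : {set T}, [/\ Q \subset S, #|Q| = t &
    {in Q &, forall x y, x != y -> ~~ E x y}].
Proof.
elim: t S => [|t IHt] S outd leS.
  by exists set0; split; rewrite ?sub0set ?cards0 // => x y; rewrite inE.
have [x Sx ind] : exists2 x, x \in S & #|[set y in S | E y x]| <= d.
  apply/exists_inP; apply: contraTT leS => /exists_inPn noind.
  have S_gt0 : 0 < #|S| -> false.
    move=> S0; suff: #|S| * d.+1 <= #|S| * d by rewrite leq_pmul2l // ltnn.
    rewrite -[X in X <= _]sum_nat_const -[X in _ <= X]sum_nat_const.
    apply: (@leq_trans (\sum_(x in S) \sum_(y in S) E y x)).
      apply: leq_sum => x /noind; rewrite -ltnNge => /leq_trans-> //.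
      by rewrite -sum1_card -big_mkcondr; apply: eq_leq; apply: eq_bigl => y;
        rewrite !inE.
    rewrite exchange_big /=; apply: leq_sum => x /outd.
    apply: leq_trans; rewrite -sum1_card -big_mkcondr; apply: eq_leq.
    by apply: eq_bigl => y; rewrite !inE.
  by rewrite -ltnNge; case: posnP S_gt0 => [-> _ | _ /(_ isT)].
pose R := x |: ([set y in S | E x y] :|: [set y in S | E y x]).
have leR : #|R| <= (d + d).+1.
  rewrite /R cardsU1; apply: (leq_add (leq_b1 _)).
  by rewrite (leq_trans (leq_card_setU _ _).1) // leq_add ?outd.
have [||Q [QS cQ indQ]] := IHt (S :\: R).
- move=> y; rewrite inE => /andP[_ /outd]; apply: leq_trans.
  by apply/subset_leq_card/subsetP => z; rewrite !inE => /andP[/andP[_ ->] ->].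
- rewrite cardsD leq_subRL; last by rewrite subset_leq_card ?subsetIl.
  apply: leq_trans leS; rewrite mulSn leq_add2r.
  by rewrite (leq_trans _ leR) // subset_leq_card ?subsetIr.
have xQ : x \notin Q.
  by apply: contraTN isT => /(subsetP QS); rewrite !inE eqxx.
have sepQ y : y \in Q -> ~~ E x y /\ ~~ E y x.
  move=> /(subsetP QS); rewrite !inE !negb_or.
  by case/andP=> /and3P[_ + +] Sy; rewrite Sy.
exists (x |: Q); split.
- by rewrite subUset sub1set Sx (subset_trans QS) ?subsetDl.
- by rewrite cardsU1 xQ cQ.
move=> y z; rewrite !inE => /predU1P[->|Qy] /predU1P[->|Qz]; rewrite ?eqxx //.
- by case: (sepQ z Qz).
- by case: (sepQ y Qy).
- exact: indQ.
Qed.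

(** * Families without large stars *)

(** A sunflower with kernel [[set v]]; the first clause makes a lone edge pass through [v] too. *)
Definition star (V : finType) (v : V) (Q : {set {set V}}) : bool :=
  [forall e in Q, v \in e] &&
  [forall e in Q, forall e' in Q, (e != e') ==> (e :&: e' == [set v])].

Lemma starP (V : finType) (v : V) (Q : {set {set V}}) :
  reflect ((forall e, e \in Q -> v \in e) /\
           (forall e e', e \in Q -> e' \in Q -> e != e' -> e :&: e' = [set v]))
          (star v Q).
Proof.
apply: (iffP andP) => [[/forall_inP vQ /forall_inP iQ] | [vQ iQ]]; split => //.
- move=> e e' Qe Qe' ne; apply/eqP.
  by have /forall_inP/(_ e' Qe')/implyP := iQ e Qe; apply.
- exact/forall_inP.
apply/forall_inP => e Qe; apply/forall_inP => e' Qe'; apply/implyP => ne.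
exact/eqP/iQ.
Qed.

(** [T] consists of the vertices other than [v] of a maximal star. By maximality, an edge through
    [v] outside the star meets some member in a further vertex; a member itself has a further vertex
    because [1 < r]. *)
Lemma star_free_link_cover (V : finType) (G : {set {set V}}) (r s : nat) (v : V) :
    1 < r -> (forall e, e \in G -> #|e| = r) ->
    (forall Q : {set {set V}}, Q \subset G -> star v Q -> #|Q| < s) ->
  exists T : {set V}, [/\ v \notin T, #|T| <= s * r &
    forall e, e \in G -> v \in e -> exists2 u, u \in e & u \in T].
Proof.
move=> r_gt1 unifG starG.
pose P (Q : {set {set V}}) := (Q \subset G) && star v Q.
have P0 : P set0.
  by rewrite /P sub0set; apply/starP; split=> [e|e e']; rewrite inE.
have [Q /maxsetP[/andP[QG starQ] maxQ] _] := maxset_exists P0.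
have [vQ iQ] := starP _ _ starQ.
exists (cover Q :\ v); split; first by rewrite !inE eqxx.
  apply: (@leq_trans (#|Q| * r)); last by rewrite leq_mul2r ltnW ?orbT ?starG.
  rewrite (leq_trans (subset_leq_card (subD1set _ _))) //.
  rewrite (leq_trans (leq_card_cover Q)) // -sum_nat_const.
  by apply: leq_sum => e /(subsetP QG)/unifG->.
move=> e Ge ve; case: (boolP (e \in Q)) => [Qe | nQe].
  have /set0Pn[u] : e :\ v != set0.
    by rewrite -card_gt0; move: r_gt1; rewrite -(unifG e Ge) (cardsD1 v) ve.
  rewrite !inE => /andP[uv ue]; exists u => //; rewrite !inE uv.
  by apply/bigcupP; exists e.
have [/exists_inP[e' Qe' ne] | /exists_inPn noe'] :=
  boolP [exists e' in Q, e :&: e' != [set v]].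
  have /subsetPn[u] : ~~ (e :&: e' \subset [set v]).
    by apply: contra ne => sub; rewrite eqEsubset sub sub1set !inE ve vQ.
  rewrite !inE => /andP[ue ue'] uv; exists u => //; rewrite !inE uv.
  by apply/bigcupP; exists e'.
case/negP: nQe; rewrite -(maxQ (e |: Q)) ?setU11 ?subsetUr //.
rewrite /P subUset sub1set Ge QG; apply/starP; split=> [f|f f'].
  by rewrite !inE => /predU1P[->|/vQ].
have eQ f'' : f'' \in Q -> e :&: f'' = [set v].
  by move/noe'; rewrite negbK => /eqP.
rewrite !inE => /predU1P[->|Qf] /predU1P[->|Qf']; rewrite ?eqxx //.
- by rewrite eQ.
- by rewrite setIC eQ.
- exact: iQ.
Qed.

(** [T] is read as a digraph with arcs from [u] to the elements of [T u]; only one step is taken. *)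
Definition out_closure (V : finType) (T : V -> {set V}) (A : {set V}) :=
  A :|: \bigcup_(u in A) T u.

Lemma card_out_closure (V : finType) (T : V -> {set V}) (c : nat) A :
  (forall v, #|T v| <= c) -> #|out_closure T A| <= #|A| * c.+1.
Proof.
move=> leT; rewrite (leq_trans (leq_card_setU _ _).1) // mulnS leq_add2l.
rewrite -sum_nat_const (@leq_trans (\sum_(u in A) #|T u|)) ?leq_sum //.
elim/big_rec2: _ => [|u m B _ IH]; first by rewrite cards0.
by rewrite (leq_trans (leq_card_setU _ _).1) // leq_add2l.
Qed.

(* Follow out-neighbours inside [e]: either some path u -> x -> y has u != y,
   or out-neighbours come in disjoint pairs and two pairs {u, x}, {u', y} fit. *)
Lemma generated_by_all_but_two (V : finType) (T : V -> {set V}) (e : {set V}) :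
    2 < #|e| -> (forall v, v \notin T v) ->
    (forall v, v \in e -> exists2 u, u \in e & u \in T v) ->
  exists2 R : {set V}, (R \subset e) && (#|R| == #|e| - 2) &
    e \subset out_closure T (out_closure T R).
Proof.
move=> e_gt2 Tirr Te.
have [g gP] : exists g : V -> V, forall v, v \in e -> (g v \in e) && (g v \in T v).
  apply: (@fin_all_exists _ (fun=> V) (fun v w => v \in e -> (w \in e) && (w \in T v))).
  move=> v; have [/Te[u ue uT]|nve] := boolP (v \in e); last by exists v.
  by exists u; rewrite ue uT.
have ge v : v \in e -> g v \in e by case/gP/andP.
have gT v : v \in e -> g v \in T v by case/gP/andP.
have gne v : v \in e -> g v != v.
  by move/gT; apply: contraTneq => ->; apply: Tirr.
(* [x] and [y] are the vertices left out: [x] is reached from [u] in one step, and [y] from [x] in a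
   second step or from [u'] directly. *)
suff [u [u' [x [y [[ue u'e xe ye] [xy ux uy] xT yT]]]]] : exists u u' x y,
   [/\ [/\ u \in e, u' \in e, x \in e & y \in e], [/\ x != y, u != x & u != y],
    x \in T u & (y \in T x) || [&& u' != x, u' != y & y \in T u']].
  exists (e :\: [set x; y]).
    rewrite subsetDl cardsD (setIidPr _) ?cards2 ?xy ?eqxx //.
    by apply/subsetP => z; rewrite !inE => /orP[] /eqP->.
  have R1 z : z \in e -> z != x -> z != y -> z \in e :\: [set x; y].
    by move=> ze zx zy; rewrite !inE negb_or zx zy ze.
  have R2 z w : z \in e -> z != x -> z != y -> w \in T z ->
      w \in out_closure T (e :\: [set x; y]).
    move=> ze zx zy wT; rewrite inE; apply/orP; right.
    by apply/bigcupP; exists z; first exact: R1.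
  apply/subsetP => z ze.
  have [->|zx] := eqVneq z x.
    by rewrite inE (R2 u).
  have [->|zy] := eqVneq z y; last by rewrite inE [X in X || _]inE R1.
  case/orP: yT => [yTx | /and3P[u'x u'y yTu']]; last first.
    by rewrite inE (R2 u').
  by rewrite inE; apply/orP; right; apply/bigcupP; exists x; rewrite ?(R2 u).
have [/exists_inP[u ue ggu] | /exists_inPn invg] := boolP [exists u in e, g (g u) != u].
  exists u, u, (g u), (g (g u)); split; first by split; rewrite ?ge.
  - split; first by rewrite eq_sym gne ?ge.
      by rewrite eq_sym gne.
    by rewrite eq_sym.
  - exact: gT.
  - by rewrite gT ?ge.
(* Now [g] is an involution of [e] without fixed points, so a third vertex of [e] lies in a second,
   disjoint pair. *)
have {}invg u : u \in e -> g (g u) = u by move/invg; rewrite negbK => /eqP.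
have /card_gt0P[u ue] : 0 < #|e| by apply: leq_trans e_gt2.
have /subsetPn[u' u'e] : ~~ (e \subset [set u; g u]).
  apply: contraTN e_gt2 => /subset_leq_card; rewrite -leqNgt => /leq_trans-> //.
  by rewrite cards2; case: (_ != _).
rewrite !inE negb_or => /andP[u'u u'gu].
exists u, u', (g u), (g u'); split; first by split; rewrite ?ge.
- split; last 1 first.
  + by apply: contra u'gu => /eqP->; rewrite invg.
  + by apply: contra u'u => /eqP ggu; rewrite -(invg u') // -ggu invg.
  + by rewrite eq_sym gne.
- exact: gT.
- by rewrite u'gu gT // eq_sym gne ?orbT.
Qed.

Lemma bin_leq_expn (n k : nat) : 'C(n, k) <= n ^ k.
Proof.
apply: leq_trans (leq_pmulr _ (fact_gt0 k)) _; rewrite bin_ffact ffact_prod.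
by rewrite -[X in n ^ X]card_ord -prod_nat_const leq_prod // => i _; apply: leq_subr.
Qed.

(** Each edge is the union of a generating (r-2)-set [R] and a subset of its two-step closure [N R].
    The first factor of the bound counts these subsets, the second the choices of [R]. *)
Lemma card_star_free (V : finType) (G : {set {set V}}) (r s : nat) :
    2 < r -> (forall e, e \in G -> #|e| = r) ->
    (forall v (Q : {set {set V}}), Q \subset G -> star v Q -> #|Q| < s) ->
  #|G| <= 2 ^ (r * (s * r).+1 * (s * r).+1) * #|V| ^ (r - 2).
Proof.
move=> r_gt2 unifG starG.
have [T TP] : exists T : V -> {set V}, forall v, [/\ v \notin T v, #|T v| <= s * r &
    forall e, e \in G -> v \in e -> exists2 u, u \in e & u \in T v].
  apply: (@fin_all_exists _ (fun=> {set V}) (fun v Tv =>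
    [/\ v \notin Tv, #|Tv| <= s * r & forall e, e \in G -> v \in e -> exists2 u, u \in e & u \in Tv])) => v.
  by apply: star_free_link_cover => //; [apply: ltnW | apply: starG].
pose N R := out_closure T (out_closure T R).
pose RR := [set R : {set V} | #|R| == r - 2].
have GR : G \subset \bigcup_(R in RR) [set R :|: P | P in powerset (N R)].
  apply/subsetP => e Ge.
  have [|v|v ve|R /andP[Re cR] eN] := @generated_by_all_but_two V T e.
  - by rewrite unifG.
  - by case: (TP v).
  - by case: (TP v) => _ _; apply.
  apply/bigcupP; exists R; first by rewrite inE (eqP cR) unifG.
  apply/imsetP; exists e; first by rewrite powersetE.
  by apply/esym/setUidPr.
rewrite (leq_trans (subset_leq_card GR)) //.
apply: (@leq_trans (\sum_(R in RR) 2 ^ (r * (s * r).+1 * (s * r).+1))).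
  apply: (@leq_trans (\sum_(R in RR) #|[set R :|: P | P in powerset (N R)]|)).
    elim/big_rec2: _ => [|R m B _ IH]; first by rewrite cards0.
    by rewrite (leq_trans (leq_card_setU _ _).1) // leq_add2l.
  apply: leq_sum => R; rewrite inE => /eqP cR.
  rewrite (leq_trans (leq_imset_card _ _)) // card_powerset leq_exp2l //.
  have leT v : #|T v| <= s * r by case: (TP v).
  rewrite (leq_trans (card_out_closure _ leT)) // leq_mul2r; apply/orP; right.
  rewrite (leq_trans (card_out_closure _ leT)) // leq_mul2r; apply/orP; right.
  by rewrite cR leq_subr.
rewrite sum_nat_const mulnC leq_mul2l; apply/orP; right.
by rewrite card_draws bin_leq_expn.
Qed.

(** * Degrees of (r-1)-sets and the number of poor edges *)

Definition extensions (V : finType) (H : {set {set V}}) (A : {set V}) : {set V} :=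
  [set x | (x \notin A) && (x |: A \in H)].

(* The weight of an edge is the sum of 1 / #|extensions H (e :\ b)| over its
   vertices b. A poor edge has weight at least 1/t; in a rich edge the j-th
   smallest of these numbers of extensions exceeds jt. Larger k need not be
   tested, as then k exceeds t * #|V|. *)
Definition poor (V : finType) (t : nat) (H : {set {set V}}) (e : {set V}) : bool :=
  [exists k : 'I_(t * #|V|).+1, (0 < k) &&
     (k <= t * #|[set b in e | #|extensions H (e :\ b)| <= k]|)].

Lemma rich_few_small (V : finType) (t : nat) (H : {set {set V}}) e k :
    ~~ poor t H e -> 0 < k ->
  t * #|[set b in e | #|extensions H (e :\ b)| <= k]| < k.
Proof.
move=> /existsPn rich k_gt0.
have [lek | gtk] := leqP k (t * #|V|); last first.
  by rewrite (leq_ltn_trans _ gtk) // leq_mul2l max_card orbT.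
have := rich (Ordinal (lek : k < (t * #|V|).+1)).
by rewrite /= k_gt0 -ltnNge.
Qed.

Lemma extensions_delete (V : finType) (H : {set {set V}}) (e : {set V}) b :
  e \in H -> b \in e -> b \in extensions H (e :\ b).
Proof. by move=> He be; rewrite !inE eqxx setD1K. Qed.

(** Double counting of weight: an (r-1)-set of degree d gives 1/d to each of d edges, so the total
    weight is at most the number of (r-1)-sets, while each poor edge takes at least 1/t. *)
Lemma card_poor (V : finType) (t r : nat) (H : {set {set V}}) :
    (forall e, e \in H -> #|e| = r) ->
  #|[set e in H | poor t H e]| <= t * 'C(#|V|, r - 1).
Proof.
(* Degrees are at most [#|V|], so scaling by [M] makes all positive weights 1/d integers. *)
move=> unifH; pose M := #|V|`!; pose deg A := #|extensions H A|.
pose w A := M %/ deg A.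
have degM A : 0 < deg A -> deg A * w A = M.
  by move=> d0; rewrite mulnC divnK // dvdn_fact // d0 max_card.
(* The witness [k] of poorness provides at least k/t vertices, each contributing at least M/k. *)
have poor_weight e : e \in H -> poor t H e -> M <= t * \sum_(b in e) w (e :\ b).
  move=> He /existsP[k /andP[k0 lek]]; rewrite -(leq_pmul2l k0).
  set B := [set b in e | _] in lek.
  apply: (@leq_trans (t * #|B| * M)); first by rewrite leq_mul2r lek orbT.
  rewrite mulnCA -mulnA leq_mul2l; apply/orP; right.
  rewrite -sum_nat_const big_distrr /= [X in _ <= X](bigID (mem B)) /=.
  apply: leq_trans (leq_addr _ _); rewrite [X in _ <= X](eq_bigl (mem B)); last first.
    by move=> b; rewrite !inE andbA andbb.
  apply: leq_sum => b; rewrite inE => /andP[be led].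
  rewrite -(degM (e :\ b)) ?leq_mul2r ?led ?orbT //.
  by apply/card_gt0P; exists b; apply: extensions_delete.
rewrite -(leq_pmul2r (fact_gt0 #|V|)) -/M -sum_nat_const.
apply: (@leq_trans (\sum_(e in H) t * \sum_(b in e) w (e :\ b))).
  rewrite [X in _ <= X](bigID (poor t H)) /= (leq_trans _ (leq_addr _ _)) //.
  rewrite (eq_bigl (fun e => (e \in H) && poor t H e)); last by move=> e; rewrite inE.
  by apply: leq_sum => e /andP[He]; apply: poor_weight.
rewrite -big_distrr /= -mulnA leq_mul2l; apply/orP; right.
(* Regroup the pairs (e, b) by [A], the set e without b. For fixed [A] the vertex b determines e and
   is an extension of [A]. *)
rewrite pair_big_dep /=.
pose AA := [set A : {set V} | #|A| == r - 1].
rewrite (partition_big (fun p : {set V} * V => p.1 :\ p.2) (mem AA)) /=; last first.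
  case=> e b /= /andP[He be]; rewrite inE -(unifH e He) (cardsD1 b e) be.
  by rewrite add1n subn1.
rewrite -(card_draws V (r - 1)) -sum_nat_const; apply: leq_sum => A _.
rewrite (eq_bigr (fun=> w A)); last by move=> p /andP[_ /eqP->].
rewrite sum_nat_cond_const; set S := [set p | _].
apply: leq_trans (leq_divM M (deg A)); rewrite mulnC leq_mul2l; apply/orP; right.
have SP p : p \in S -> [/\ p.1 \in H, p.2 \in p.1 & p.1 :\ p.2 = A].
  by rewrite inE => /andP[/andP[-> ->] /eqP->].
rewrite -(@card_in_imset _ _ snd S); last first.
  case=> e b [e' b'] /SP[/= _ be eA] /SP[/= _ be' e'A] bb'.
  by rewrite -(setD1K be) -(setD1K be') eA e'A bb'.
apply/subset_leq_card/subsetP => _ /imsetP[p /SP[He be <-] ->].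
exact: extensions_delete.
Qed.

(** * Embedding F(t, r) into a large star of rich edges *)

(** Away from [v] the edges of a star are disjoint, so each element of [U] hits at most one of
    them. *)
Lemma card_star_hit (V : finType) (v : V) (Q : {set {set V}}) (U : {set V}) :
  star v Q -> #|[set e in Q | ~~ [disjoint U & e :\ v]]| <= #|U|.
Proof.
case/starP=> vQ iQ; set S := [set e in Q | _].
pose h (e : {set V}) := odflt v [pick u in U :&: (e :\ v)].
have hP e : e \in S -> [/\ e \in Q, h e \in U, h e != v & h e \in e].
  rewrite inE -setI_eq0 /h => /andP[Qe /set0Pn[u ue]].
  by case: pickP => [u' | /(_ u)]; [rewrite !inE => /and3P[] | rewrite ue].
rewrite -(@card_in_imset _ _ h S).
  by apply/subset_leq_card/subsetP => _ /imsetP[e /hP[_ hU _ _] ->].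
move=> e e' /hP[Qe _ hv he] /hP[Qe' _ _ he'] hh; apply/eqP/contraT => ne.
have /setP/(_ (h e)) := iQ e e' Qe Qe' ne.
by rewrite !inE he hh he' -hh (negPf hv).
Qed.

Lemma pointed_enumeration (V : finType) (k : nat) (e : {set V}) v :
    v \in e -> #|e| = k.+1 ->
  exists c : option 'I_k -> V,
    [/\ injective c, c None = v & c @: [set: option 'I_k] = e].
Proof.
move=> ve ce; have ck : k = #|e :\ v| by move: ce; rewrite (cardsD1 v) ve => -[].
pose c m := if m is Some j then enum_val (cast_ord ck j) else v.
have cD j : c (Some j) \in e :\ v by apply: enum_valP.
have injc : injective c.
  case=> [j|] [j'|] //=.
  - by move/enum_val_inj/cast_ord_inj->.
  - by have := cD j; rewrite !inE => /andP[/eqP].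
  - by have := cD j'; rewrite !inE => /andP[/eqP + _] => /[swap] /esym.
exists c; split => //; apply/eqP; rewrite eqEcard card_imset // ce.
rewrite cardsT card_option card_ord leqnn andbT.
by apply/subsetP => _ /imsetP[[j|] _ ->] //; have := cD j; rewrite inE => /andP[].
Qed.

Lemma calF_edgeE (t r : nat) (i : 'I_t) (m : option 'I_r.-1) :
  calF_edge i m = omap (pair i) @: [set~ m].
Proof.
have injp : injective (omap (pair i) : option 'I_r.-1 -> coreV t r).
  by case=> [j|] [j'|] // [->].
apply/setP => z; rewrite inE; apply/andP/imsetP => [[iz zm] | [m' mm' ->]].
  suff [m' zE] : exists m', z = omap (pair i) m'.
    by exists m' => //; rewrite !inE; apply: contra zm => /eqP<-; rewrite zE.
  case: z iz {zm} => [[i' j]|] /= iz; last by exists None.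
  by exists (Some j); rewrite /= (eqP iz).
split; first by case: m' {mm'} => [j|] //=.
by rewrite (inj_eq injp); move: mm'; rewrite !inE.
Qed.

Lemma rich_star_contains (n t r : nat) (H Q : {set {set 'I_n}}) v :
    0 < r -> 0 < t -> (forall e, e \in H -> #|e| = r) ->
    (forall e, e \in Q -> e \in H /\ ~~ poor t H e) -> star v Q ->
    t * (r * (r * t) + r * (r * t)).+1 <= #|Q| ->
  contains (F_edges t r) H.
Proof.
move=> r0 t0 unifH QH starQ leQ; have [vQ iQ] := starP _ _ starQ.
(* Adding [b] gives back [e] itself; a new vertex must lie outside [e], so [b] is removed. *)
pose X (e : {set 'I_n}) b := extensions H (e :\ b) :\ b.
(* F(t, r) has [r * t] new vertices, so that many candidates suffice; truncation bounds [U e]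
   independently of [n]. *)
pose Y (e : {set 'I_n}) b := [set:: take (r * t) (enum (X e b))].
have YX e b : Y e b \subset X e b.
  by apply/subsetP => x; rewrite inE => /mem_take; rewrite mem_enum.
have cY e b : #|Y e b| = minn (r * t) #|X e b|.
  by rewrite cardsE (card_uniqP _) ?take_uniq ?enum_uniq // size_take_min -cardE.
pose U (e : {set 'I_n}) := \bigcup_(b in e) Y e b.
have cU e : e \in Q -> #|U e| <= r * (r * t).
  move=> /QH[/unifH ce _]; rewrite -[X in X * (r * t)]ce -sum_nat_const.
  apply: (@leq_trans (\sum_(b in e) #|Y e b|)).
    rewrite /U; elim/big_rec2: _ => [|b m B _ IH]; first by rewrite cards0.
    by rewrite (leq_trans (leq_card_setU _ _).1) // leq_add2l.
  by apply: leq_sum => b _; rewrite cY geq_minl.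
(* Independence for [E] keeps the candidates of one chosen edge off the other chosen edges. *)
pose E (e e' : {set 'I_n}) := ~~ [disjoint U e & e' :\ v].
have [|Q' [Q'Q cQ' indQ']] := @independent_subset _ E _ t Q _ leQ.
  by move=> e Qe; apply: leq_trans (cU e Qe); apply: card_star_hit.
pose e (i : 'I_t) : {set 'I_n} := enum_val (cast_ord (esym cQ') i).
have inje : injective e by move=> i i' /enum_val_inj/cast_ord_inj.
have eQ' i : e i \in Q' by apply: enum_valP.
have eQ i : e i \in Q by apply: (subsetP Q'Q).
have ce i : #|e i| = r.-1.+1 by rewrite prednK // unifH //; case: (QH _ (eQ i)).
have [c cP] : exists c : 'I_t -> option 'I_r.-1 -> 'I_n, forall i,
    [/\ injective (c i), c i None = v & c i @: [set: option 'I_r.-1] = e i].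
  apply: (@fin_all_exists _ (fun=> option 'I_r.-1 -> 'I_n) (fun i c => [/\ injective c,
    c None = v & c @: [set: option 'I_r.-1] = e i])) => i.
  by apply: pointed_enumeration; rewrite ?ce ?vQ.
have injc i : injective (c i) by case: (cP i).
have cN i : c i None = v by case: (cP i).
have cE i : c i @: [set: option 'I_r.-1] = e i by case: (cP i).
have ce_in i m : c i m \in e i by rewrite -cE imset_f.
have [|x injx xY] := @distinct_representatives ('I_t * option 'I_r.-1)%type _
    (fun p => Y (e p.1) (c p.1 p.2)).
  (* For [k] at least [r * t] there are only [r * t] pairs in all. For smaller [k], a small [Y]
     means at most [k.+1] extensions; richness is strict, which makes up for the removed vertex, and
     leaves at most k/t such pairs for each of the [t] edges. *)
  move=> k; have [lek | gtk] := leqP (r * t) k.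
    rewrite (leq_trans (max_card _)) // card_prod card_option !card_ord prednK //.
    by rewrite mulnC.
  rewrite -(leq_pmul2l t0) -sum1dep_card.
  rewrite -(pair_big_dep xpredT (fun i m => #|Y (e i) (c i m)| <= k) (fun _ _ => 1)) /=.
  rewrite big_distrr /= -[X in X * k]card_ord -sum_nat_const leq_sum // => i _.
  have [Hi richi] := QH _ (eQ i).
  rewrite -ltnS; apply: leq_ltn_trans (rich_few_small richi (ltn0Sn k)).
  rewrite leq_mul2l sum1dep_card -(card_imset _ (injc i)); apply/orP; right.
  apply/subset_leq_card/subsetP => _ /imsetP[m + ->]; rewrite !inE ce_in cY.
  rewrite geq_min leqNgt gtk /= => leX.
  by rewrite (cardsD1 (c i m)) extensions_delete ?ce_in.
have xX p : x p \in X (e p.1) (c p.1 p.2) by apply: (subsetP (YX _ _)).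
have xnotin p i : x p \notin e i.
  have xp : x p \notin e p.1.
    by have := xX p; rewrite !inE => /and3P[xc + _]; rewrite xc.
  have [<- // | pi] := eqVneq p.1 i.
  have /negPn dis := indQ' _ _ (eQ' p.1) (eQ' i) (contra_neq (inje _ _) pi).
  have xU : x p \in U (e p.1) by apply/bigcupP; exists (c p.1 p.2).
  have := disjointFr dis xU; rewrite !inE => /negbT; rewrite negb_and negbK.
  by case/orP=> // /eqP xv; rewrite xv vQ in xp.
pose f (z : FV t r) := match z with
  | inl None => v | inl (Some (i, j)) => c i (Some j) | inr p => x p end.
have fc i m : f (inl (omap (pair i) m)) = c i m by case: m => [j|] //=.
apply/existsP; exists (finfun f); apply/andP; split.
  apply/injectiveP => z z'; rewrite !ffunE.
  have core y : f (inl y) \in [set u | [exists i, u \in e i]].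
    rewrite inE; case: y => [[i j]|] /=; apply/existsP.
      by exists i.
    by exists (Ordinal t0); rewrite vQ.
  have mixed y p : f (inl y) <> x p.
    by have := core y => /[swap] ->; rewrite inE => /existsP[i]; apply/negP.
  case: z z' => [y|p] [y'|p'].
  - have Some_v i j : c i (Some j) <> v by rewrite -(cN i) => /injc.
    case: y y' => [[i j]|] [[i' j']|] //= fE.
    + have [ii|ii] := eqVneq i i'; first by move: fE; rewrite ii => /injc[->].
      have /setP/(_ (c i (Some j))) :=
        iQ _ _ (eQ i) (eQ i') (contra_neq (inje _ _) ii).
      by rewrite !inE ce_in fE ce_in -fE => /esym/eqP/Some_v.
    + by case: (Some_v _ _ fE).
    + by case: (Some_v _ _ (esym fE)).
  - by move/mixed.
  - by move/esym/mixed.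
  - by move=> /= /injx->.
apply/forall_inP => _ /imset2P[i m _ _ ->].
have -> : finfun f @: F_edge i m = x (i, m) |: (e i :\ c i m).
  rewrite /F_edge imsetU imset_set1 ffunE setUC calF_edgeE -!imset_comp.
  rewrite (eq_imset (g := c i)) => [|m' /=]; last by rewrite ffunE fc.
  congr (_ :|: _); apply/setP => u; rewrite !inE -(cE i).
  apply/imsetP/andP => [[m' + ->] | [um /imsetP[m' _ uE]]].
    by rewrite !inE (inj_eq (injc i)) imset_f.
  by exists m' => //; rewrite !inE; apply: contra um => /eqP<-; rewrite uE.
by have := xX (i, m); rewrite !inE => /and3P[].
Qed.

(** * Vertex covers of F(t, r) and an F(t, r)-free hypergraph *)

Definition edges_meeting (V : finType) (r : nat) (S : {set V}) : {set {set V}} :=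
  [set e : {set V} | (#|e| == r) && ~~ [disjoint e & S]].

Lemma card_edges_meeting (V : finType) (r : nat) (S : {set V}) :
  #|edges_meeting r S| + 'C(#|V| - #|S|, r) = 'C(#|V|, r).
Proof.
have -> : #|V| - #|S| = #|~: S| by rewrite [RHS]cardsCs setCK.
rewrite -(card_draws V r) -(cards_draws (~: S) r) addnC.
rewrite -[RHS](cardsID [set e : {set V} | [disjoint e & S]]).
by congr (_ + _); apply: eq_card => e; rewrite !inE ?disjoints_subset andbC.
Qed.

(* No vertex lies in all edges of one copy, so a cover of F(t, r) picks for each
   copy a vertex outside the others, plus the common vertex or a second vertex
   of the same copy. *)
Lemma F_cover_card (t r : nat) (P : {set FV t r}) :
    1 < r -> 0 < t -> (forall i m, ~~ [disjoint F_edge i m & P]) -> t < #|P|.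
Proof.
move=> r1 t0 cov.
(* The copy to which a vertex belongs, a new vertex going with the edge it extends; the common
   vertex belongs to none. *)
pose region (z : FV t r) : option 'I_t := match z with
  | inl None => None | inl (Some p) => Some p.1 | inr p => Some p.1 end.
have edge_region i m z : z \in F_edge i m ->
    (region z == Some i) || (region z == None) && (m != None).
  rewrite !inE => /orP[/imsetP[y + ->] | /eqP->] /=; last by rewrite eqxx.
  rewrite inE; case: y => [[i' j]|] /=; first by case/andP=> /eqP-> _; rewrite eqxx.
  by case: m.
have avoid i z : region z = Some i -> exists m, z \notin F_edge i m.
  case: z => [[[i' j]|]|[i' m]] //= [->].
    exists (Some j); rewrite !inE orbF mem_imset; last by move=> ? ? [].
    by rewrite inE /= !eqxx.
  have [m' mm'] : exists m' : option 'I_r.-1, m' != m.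
    case: m => [j|]; first by exists None.
    have r0 : 0 < r.-1 by case: (r) r1 => [|[]].
    by exists (Some (Ordinal r0)).
  exists m'; rewrite !inE negb_or; apply/andP; split; first by apply/imsetP => -[].
  by apply: contra mm' => /eqP[->].
have covP i m : exists2 z, z \in P & z \in F_edge i m.
  by have /pred0Pn[z /andP[/= zF zP]] := cov i m; exists z.
have [h hP] : exists h : 'I_t -> FV t r,
    forall i, (h i \in P) && (region (h i) == Some i).
  apply: (@fin_all_exists _ (fun=> FV t r)
    (fun i z => (z \in P) && (region z == Some i))).
  move=> i; have [z zP /edge_region zi] := covP i None; exists z.
  by rewrite zP; move: zi; rewrite andbF orbF.
have hr i : region (h i) = Some i by have /andP[_ /eqP] := hP i.
have injh : injective h.
  by move=> i i' hh; have := hr i; rewrite hh hr => -[].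
suff [z zP zh] : exists2 z, z \in P & z \notin h @: [set: 'I_t].
  apply: (@leq_trans #|z |: h @: [set: 'I_t]|).
    by rewrite cardsU1 zh card_imset // cardsT card_ord.
  apply/subset_leq_card; rewrite subUset sub1set zP.
  by apply/subsetP => _ /imsetP[i _ ->]; case/andP: (hP i).
(* Covering an edge of copy [i0] that avoids [h i0] needs a vertex other than all the [h i]. *)
pose i0 := Ordinal t0; have [m hm] := avoid i0 _ (hr i0).
have [z zP zm] := covP i0 m; exists z => //; apply/imsetP => -[i _ zE].
have := edge_region _ _ _ zm; rewrite zE hr /= orbF => /eqP[ii].
by rewrite (_ : h i0 = z) ?zm ?zE ?ii in hm.
Qed.

(** The preimage of [S] under an embedding would be a vertex cover of F(t, r) with at most [t]
    vertices. *)
Lemma edges_meeting_F_free (n t r : nat) (S : {set 'I_n}) :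
    1 < r -> 0 < t -> #|S| <= t -> ~~ contains (F_edges t r) (edges_meeting r S).
Proof.
move=> r1 t0 leS; apply/existsPn => f.
apply/negP => /andP[/injectiveP injf /forall_inP fH].
suff: t < #|f @^-1: S|.
  apply/negP; rewrite -leqNgt -(card_imset _ injf) (leq_trans _ leS) //.
  by apply/subset_leq_card/subsetP => _ /imsetP[z + ->]; rewrite inE.
apply: F_cover_card => // i m.
have : f @: F_edge i m \in edges_meeting r S by apply: fH; apply: imset2_f.
rewrite inE => /andP[_ /pred0Pn[_ /andP[/imsetP[z zF ->] fS]]].
by apply/pred0Pn; exists z; rewrite /= zF inE.
Qed.

(** * Binomial estimates and the two bounds *)

(** Pascal's rule applied [t] times, each increment being at least ['C(m, k)]. *)
Lemma bin_shift_lower (m t k : nat) :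
  'C(m, k.+1) + t * 'C(m, k) <= 'C(t + m, k.+1).
Proof.
elim: t => [|t IHt]; first by rewrite mul0n addn0.
rewrite addSn binS mulSn addnCA addnC leq_add //.
by rewrite leq_bin2l ?leq_addl.
Qed.

Lemma bin_shift_upper (m t k : nat) :
  'C(t + m, k.+1) <= 'C(m, k.+1) + t * (t + m) ^ k.
Proof.
elim: t => [|t IHt]; first by rewrite mul0n addn0.
have mono : (t + m) ^ k <= (t.+1 + m) ^ k by case: k {IHt} => // k; rewrite leq_exp2r.
rewrite addSn binS mulSn addnCA addnC leq_add //.
  by rewrite (leq_trans (bin_leq_expn _ _)).
by rewrite (leq_trans IHt) // leq_add2l leq_mul2l mono orbT.
Qed.

(** The r-sets meeting a t-set number at least t C(n-t, r-1); replacing n-t by n there changes this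
    by at most t t n^(r-2). *)
Lemma ex_F_lower (r t n : nat) : 2 <= r -> 0 < t -> t <= n ->
  t * 'C(n, r - 1) <= ex r n (F_edges t r) + t * t * n ^ (r - 2).
Proof.
move=> r2 t0 tn.
pose S : {set 'I_n} := [set i : 'I_n | i < t].
have cS : #|S| = t.
  by rewrite -sum1dep_card -(big_ord_widen n (fun=> 1) tn) sum1_card card_ord.
have leH : #|edges_meeting r S| <= ex r n (F_edges t r).
  apply: (leq_bigmax_cond (F := fun H : {set {set 'I_n}} => #|H|)).
  rewrite edges_meeting_F_free ?cS // ?andbT.
  by apply/forall_inP => e; rewrite inE => /andP[].
apply: leq_trans (leq_add leH (leqnn _)).
have := card_edges_meeting r S; rewrite cS card_ord => cH.
rewrite -(leq_add2l 'C(n - t, r)) addnA [_ + #|_|]addnC cH.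
case: r r2 {leH cH} => [|[|k]] // _; rewrite !subSS !subn0.
have nE : n = t + (n - t) by rewrite subnKC.
set m := n - t in nE *; rewrite nE.
apply: (@leq_trans ('C(m, k.+2) + t * 'C(m, k.+1) + t * t * (t + m) ^ k)).
  rewrite -addnA leq_add2l -mulnA -mulnDr leq_mul2l; apply/orP; right.
  exact: bin_shift_upper.
by rewrite leq_add2r bin_shift_lower.
Qed.

Lemma ex_F_upper (r t : nat) : 2 < r -> 0 < t ->
  exists C, forall n, ex r n (F_edges t r) <= t * 'C(n, r - 1) + C * n ^ (r - 2).
Proof.
(* A star of [s] rich edges yields F(t, r), so the rich edges of an F(t, r)-free hypergraph contain
   only smaller stars. *)
move=> r2 t0; pose s := t * (r * (r * t) + r * (r * t)).+1.
exists (2 ^ (r * (s * r).+1 * (s * r).+1)) => n.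
apply/bigmax_leqP => H /andP[/forall_inP unif free].
have unifH e : e \in H -> #|e| = r by move/unif/eqP.
rewrite -(cardsID [set e | poor t H e] H); apply: leq_add.
  have := card_poor t unifH; rewrite card_ord; apply: leq_trans.
  by apply/eq_leq/eq_card => e; rewrite !inE.
rewrite -[X in _ * X ^ _]card_ord; apply: card_star_free => // [e | v Q QG starQ].
  by rewrite !inE => /andP[_ /unifH].
rewrite ltnNge; apply: contra free => leQ.
apply: rich_star_contains starQ leQ => //; first exact: leq_trans r2.
by move=> e /(subsetP QG); rewrite !inE => /andP[].
Qed.

(* ex_r(n, F(t,r)) = t * C(n, r-1) + O(n^(r-2)) as n -> oo *)
Theorem theorem2 (r t : nat) : 3 <= r -> 1 < t ->
  exists (C N : nat), forall n : nat, N <= n ->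
    ex r n (F_edges t r) <= t * 'C(n, r - 1) + C * n ^ (r - 2) /\
    t * 'C(n, r - 1) <= ex r n (F_edges t r) + C * n ^ (r - 2).
Proof.
move=> r3 /ltnW t0; have [C ubC] := ex_F_upper r3 t0.
(* The threshold [t] leaves room for the t-set of the lower bound. *)
exists (C + t * t), t => n tn; split.
  by rewrite (leq_trans (ubC n)) // leq_add2l leq_mul2r leq_addr orbT.
rewrite (leq_trans (ex_F_lower (ltnW r3) t0 tn)) // leq_add2l.
by rewrite leq_mul2r leq_addl orbT.
Qed.
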